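(* An unsatisfiable clause-set $F$ is a total mps if and only if $F \in \mathrm{SMU}_{\delta=1}$.
   Context: Clauses are finite sets of literals without complementary pair; clause-sets are finite sets of clauses; $\top$ is the empty clause-set. $G \models C$ means every satisfying assignment of $G$ satisfies $C$. A clause-set $G$ is a minimal premise set (mps) for a clause $C$ if $G\models C$ and no proper subset of $G$ implies $C$; $G$ is an mps if it is an mps for some clause. A clause-set $F\ne\top$ is a total mps if every nonempty subset of $F$ is an mps. $F$ is minimally unsatisfiable if it is unsatisfiable but $F\setminus\{C\}$ is satisfiable for every $C\in F$; it is saturated minimally unsatisfiable if moreover for every $C\in F$ and every literal $x$ with $\mathrm{var}(x)\notin\mathrm{var}(C)$ the clause-set $(F\setminus\{C\})\cup\{C\cup\{x\}\}$ is satisfiable. The deficiency is $\delta(F) = |F| - |\mathrm{var}(F)|$. $\mathrm{SMU}_{\delta=1}$ is the set of saturated minimally unsatisfiable clause-sets of deficiency $1$. *)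

(* Defs.v *)
From mathcomp Require Import all_boot all_order all_algebra finmap.

Set Implicit Arguments.
Unset Strict Implicit.
Unset Printing Implicit Defensive.

Import GRing.Theory.

Local Open Scope fset_scope.

(* The literal (v, true) is the variable v, (v, false) is its negation. *)
Definition literal (V : choiceType) := (V * bool)%type.

Section ClauseSets.

Variable V : choiceType.

Implicit Types (C D : {fset literal V}) (F G : {fset {fset literal V}}).

Definition lvar (x : literal V) : V := x.1.
Definition lneg (x : literal V) : literal V := (x.1, ~~ x.2).

Definition is_clause C : Prop := forall x, x \in C -> lneg x \notin C.
Definition is_clause_set F : Prop := forall C, C \in F -> is_clause C.

Definition cvars C : {fset V} := [fset lvar x | x in C].
Definition vars F : {fset V} := \bigcup_(C <- F) cvars C.

Definition satisfies_clause (phi : V -> bool) C : Prop :=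
  exists2 x, x \in C & phi (lvar x) = x.2.
Definition satisfies (phi : V -> bool) F : Prop :=
  forall C, C \in F -> satisfies_clause phi C.

Definition satisfiable F : Prop := exists phi, satisfies phi F.
Definition unsatisfiable F : Prop := ~ satisfiable F.

Definition entails F C : Prop :=
  forall phi, satisfies phi F -> satisfies_clause phi C.

Definition mps_for G C : Prop :=
  entails G C /\ (forall G', G' `<` G -> ~ entails G' C).
Definition mps G : Prop := exists2 C, is_clause C & mps_for G C.
Definition total_mps F : Prop :=
  F <> fset0 /\ (forall G, G `<=` F -> G <> fset0 -> mps G).

Definition minimally_unsatisfiable F : Prop :=
  unsatisfiable F /\ (forall C, C \in F -> satisfiable (F `\ C)).

Definition saturated_minimally_unsatisfiable F : Prop :=
  minimally_unsatisfiable F /\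
  (forall C x, C \in F -> lvar x \notin cvars C ->
     satisfiable ((F `\ C) `|` [fset C `|` [fset x]])).

Definition deficiency F : int := (#|` F|%:Z - #|` vars F|%:Z)%R.

Definition SMU1 F : Prop :=
  saturated_minimally_unsatisfiable F /\ deficiency F = 1%R.

End ClauseSets.

(* Main.v *)
(* A minimal premise set is one for the clause of its pure literals, and
   deleting a clause from it makes some further variable occur purely. Hence a
   total mps has at most one clause more than it has variables, and Tarsi's
   lemma gives the other bound in the unsatisfiable case. As any two clauses of
   a total mps clash, falsifying one of them satisfies all the others, which
   gives saturation.

   Conversely, a variable of minimal degree in an SMU of deficiency 1 occurs
   exactly once in each sign, and by saturation in two clauses of the form
   {x} u C and {-x} u C. Replacing them by C yields a smaller SMU of deficiency
   1, and undoing this replacement preserves being a total mps. *)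
Require Import Defs.
From mathcomp Require Import all_boot all_order all_algebra finmap.
From mathcomp Require Import zify.
From Stdlib Require Import Classical.

Set Implicit Arguments.
Unset Strict Implicit.
Unset Printing Implicit Defensive.

Local Open Scope fset_scope.

Section TotalMinimalPremiseSets.

Variable V : choiceType.

Implicit Types (x y : literal V) (v w : V) (phi : V -> bool).
Implicit Types (B C D E : {fset literal V}) (F G H K R : {fset {fset literal V}}).

(** * Literals, clauses and variables *)

Lemma lnegK : involutive (@lneg V).
Proof. by case=> v b; rewrite /lneg /= negbK. Qed.

Lemma eq_lvar x y : lvar y = lvar x -> y = x \/ y = lneg x.
Proof.
case: x y => v b [w c]; rewrite /lvar /lneg /= => ->.
by case: b c => [] []; auto.
Qed.

Lemma lvar_cvars C x : x \in C -> lvar x \in cvars C.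
Proof. by move=> xC; apply/imfsetP; exists x. Qed.

Lemma cvarsP C v : reflect (exists2 x, x \in C & lvar x = v) (v \in cvars C).
Proof.
by apply: (iffP (imfsetP _ _ _ _)) => -[x /= xC xv]; exists x => //; rewrite xv.
Qed.

Lemma varsP F v : reflect (exists2 C, C \in F & v \in cvars C) (v \in vars F).
Proof.
apply: (iffP (bigfcupP _ _ _ _)) => -[C CF vC]; exists C => //.
  by rewrite andbT in CF.
by rewrite CF.
Qed.

Lemma varsU G H : vars (G `|` H) = vars G `|` vars H.
Proof.
apply/fsetP=> v; rewrite inE; apply/varsP/orP.
  move=> [C]; rewrite inE => /orP[CG|CH] vC; [left|right];
  by apply/varsP; exists C.
by move=> [] /varsP[C CG vC]; exists C => //; rewrite inE CG ?orbT.
Qed.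

Lemma vars0 : vars (fset0 : {fset {fset literal V}}) = fset0.
Proof.
by apply/fsetP=> v; rewrite in_fset0; apply/negbTE/negP => /varsP[C]; rewrite in_fset0.
Qed.

Lemma cvars_sub F C : C \in F -> cvars C `<=` vars F.
Proof. by move=> CF; apply/fsubsetP=> v vC; apply/varsP; exists C. Qed.

Lemma vars_mono G H : G `<=` H -> vars G `<=` vars H.
Proof.
by move=> /fsubsetP GH; apply/fsubsetP=> v /varsP[C CG vC]; apply/varsP; exists C; auto.
Qed.

Lemma satisfies_mono phi G H : G `<=` H -> satisfies phi H -> satisfies phi G.
Proof. by move=> /fsubsetP GH sH C /GH /sH. Qed.

Lemma satisfiesU1 phi C F :
  satisfies_clause phi C -> satisfies phi F -> satisfies phi (C |` F).
Proof. by move=> sC sF D; rewrite !inE => /orP[/eqP->|/sF]. Qed.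

Lemma satisfies_D1 phi C F :
  satisfies phi (F `\ C) -> satisfies_clause phi C -> satisfies phi F.
Proof.
move=> sF sC D DF; have [->//|nDC] := eqVneq D C.
by apply: sF; rewrite !inE nDC.
Qed.

Lemma satisfies_clauseU1 phi x C : satisfies_clause phi (x |` C) ->
  phi (lvar x) = x.2 \/ satisfies_clause phi C.
Proof.
case=> y; rewrite !inE => /orP[/eqP->|yC] yt; [by left|].
by right; exists y.
Qed.

Lemma satisfies_clause_mono phi C D :
  C `<=` D -> satisfies_clause phi C -> satisfies_clause phi D.
Proof. by move=> /fsubsetP CD [y /CD]; exists y. Qed.

Lemma satisfies_clause1 phi x C :
  phi (lvar x) = x.2 -> satisfies_clause phi (x |` C).
Proof. by exists x => //; rewrite !inE eqxx. Qed.

(** * Changing assignments *)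

Definition upd phi x : V -> bool := fun w => if w == lvar x then x.2 else phi w.

Lemma updE phi x : upd phi x (lvar x) = x.2.
Proof. by rewrite /upd eqxx. Qed.

Lemma upd_other phi x w : w != lvar x -> upd phi x w = phi w.
Proof. by rewrite /upd => /negbTE ->. Qed.

Lemma upd_clause phi x C : lvar x \notin cvars C ->
  satisfies_clause (upd phi x) C <-> satisfies_clause phi C.
Proof.
move=> vC; have eqv y : y \in C -> upd phi x (lvar y) = phi (lvar y).
  move=> yC; apply: upd_other; apply: contraNneq vC => <-.
  exact: lvar_cvars.
by split=> -[y yC yt]; exists y => //; rewrite -?eqv // eqv.
Qed.

Lemma upd_satisfies phi x F : lvar x \notin vars F ->
  satisfies (upd phi x) F <-> satisfies phi F.
Proof.
move=> vF; split=> sF C CF; have := sF C CF; apply upd_clause;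
by apply: contraNN vF => vC; apply/varsP; exists C.
Qed.

Lemma upd_keeps phi x C :
  lneg x \notin C -> satisfies_clause phi C -> satisfies_clause (upd phi x) C.
Proof.
move=> nx [y yC yt]; exists y => //.
have [eqv|nv] := eqVneq (lvar y) (lvar x); last by rewrite upd_other.
by case: (eq_lvar eqv) => ye; [rewrite ye updE | rewrite ye (negPf nx) in yC].
Qed.

(** When [B] has no complementary pair the two tests never compete, and this makes all literals of
    [B] false while following [phi] elsewhere. *)
Definition falsify B phi : V -> bool :=
  fun w => if (w, true) \in B then false else ((w, false) \in B) || phi w.

Lemma falsify_neg B phi x : is_clause B -> x \in B -> falsify B phi (lvar x) = ~~ x.2.
Proof.
case: x => v [] cB xB; rewrite /falsify /=; first by rewrite xB.
by have := cB _ xB; rewrite /lneg /= => /negbTE->; rewrite xB.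
Qed.

Lemma falsify_other B phi x : x \notin B -> lneg x \notin B ->
  falsify B phi (lvar x) = phi (lvar x).
Proof.
by case: x => v []; rewrite /falsify /lneg /lvar /= => /negbTE-> /negbTE->.
Qed.

Lemma falsifyP B phi : is_clause B -> ~ satisfies_clause (falsify B phi) B.
Proof. by move=> cB [x xB]; rewrite falsify_neg //; case: x.2. Qed.

Lemma falsify_hit B phi x : is_clause B -> lneg x \in B -> falsify B phi (lvar x) = x.2.
Proof. by move=> cB /(falsify_neg phi cB) /=; rewrite negbK. Qed.

(** * Hall's theorem and Tarsi's lemma *)

(** Since the witnesses have their variables in [Y], changing the assignment outside [Y] does no
    harm, so assignments for disjoint variable sets can be glued. *)
Definition sat_within (Y : {fset V}) phi F : Prop :=
  forall C, C \in F -> exists x, [/\ x \in C, lvar x \in Y & phi (lvar x) = x.2].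

Lemma sat_within_sat Y phi F : sat_within Y phi F -> satisfies phi F.
Proof. by move=> sF C /sF[x [xC _ xt]]; exists x. Qed.

Lemma sat_within_glue (Y Z : {fset V}) phi psi G H :
  Y `<=` Z -> sat_within Y phi G -> sat_within (Z `\` Y) psi H ->
  exists chi, sat_within Z chi (G `|` H).
Proof.
move=> /fsubsetP YZ sG sH; exists (fun w => if w \in Y then phi w else psi w) => C.
rewrite inE => /orP[/sG|/sH] [x []] xC; rewrite ?inE.
  by move=> xY xt; exists x; rewrite xY; split; auto.
by move=> /andP[/negbTE xY xZ] xt; exists x; rewrite xY.
Qed.

(* This is Hall's theorem for the incidence between clauses and variables,
   proved directly on assignments: a tight subfamily is satisfied with its own
   variables; without tight subfamilies any literal may be fixed first. *)
Lemma hall_sat (Y : {fset V}) F :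
  (forall G, G `<=` F -> #|` G| <= #|` vars G `&` Y|) ->
  exists phi, sat_within Y phi F.
Proof.
have [n] := ubnP #|` F|; elim: n => // n IH in Y F *; rewrite ltnS => Fn hF.
case: (eqVneq F fset0) => [->|F0]; first by exists xpredT.
case: (classic (exists G, [/\ G `<` F, G != fset0 & #|` vars G `&` Y| = #|` G|])).
  move=> [G [GF G0 tG]].
  have GF' := fproper_sub GF.
  have [|K KG|phi sG] := IH (vars G `&` Y) G.
  - by apply: leq_trans Fn; apply: fproper_ltn_card.
  - have -> : vars K `&` (vars G `&` Y) = vars K `&` Y.
      by rewrite fsetIA (fsetIidPl (vars_mono KG)).
    by apply: hF; apply: fsubset_trans GF'.
  (* Hall's condition survives on the remaining variables: a violating [K], joined with the tight
     [G], would violate it for [F]. *)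
  have [|K KFG|psi sH] := IH (Y `\` (vars G `&` Y)) (F `\` G).
  - apply: leq_trans Fn; rewrite cardfsDS //.
    move: G0; rewrite -cardfs_gt0 => ?; have := fsubset_leq_card GF'; lia.
  - have dKG : [disjoint K & G]%fset.
      by apply: fdisjointWl KFG _; rewrite fdisjoint_sym; apply/fdisjointP => C CG; rewrite inE CG.
    have := hF (K `|` G); rewrite fsubUset GF' (fsubset_trans KFG (fsubsetDl _ _)).
    move=> /(_ isT); rewrite varsU fsetIUl => le1.
    have : #|` (vars K `&` Y `|` vars G `&` Y)| <=
           #|` vars K `&` (Y `\` vars G `&` Y)| + #|` vars G `&` Y|.
      rewrite -cardfsUI; apply: leq_trans (leq_addr _ _).
      apply: fsubset_leq_card; apply/fsubsetP=> v; rewrite !inE.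
      by case: (v \in vars K); case: (v \in vars G); case: (v \in Y).
    have := cardfsUI K G; move: dKG; rewrite -fsetI_eq0 => /eqP->.
    rewrite cardfs0; lia.
  have [chi sF] := sat_within_glue (fsubsetIr _ _) sG sH.
  by exists chi; rewrite fsetUDl fsetDv fsetD0 (fsetUidPr _ _ GF') in sF.
(* Without tight subfamilies every nonempty proper one has a spare variable, which pays for giving
   up [v] to satisfy [C]. *)
move=> ntight; have [C CF] := fset0Pn _ F0.
have /fset0Pn[v] : vars [fset C] `&` Y != fset0.
  by rewrite -cardfs_gt0 -{1}(cardfs1 C); apply: hF; rewrite fsub1set.
rewrite inE => /andP[/varsP[D]]; rewrite inE => /eqP-> /cvarsP[x xC xv] vY.
have [|K KF|phi sH] := IH (Y `\` [fset v]) (F `\ C).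
- by apply: leq_trans Fn; rewrite (cardfsD1 C F) CF.
- have [->|K0] := eqVneq K fset0; first by rewrite cardfs0.
  have KpF : K `<` F.
    rewrite fproperEneq (fsubset_trans KF (fsubD1set _ _)) andbT.
    by apply/eqP=> KE; move: KF; rewrite KE => /fsubsetP /(_ _ CF); rewrite !inE eqxx.
  have le1 := hF K (fproper_sub KpF).
  have lt1 : #|` K| < #|` vars K `&` Y|.
    rewrite ltn_neqAle le1 andbT; apply/eqP => KE; apply: ntight.
    by exists K.
  rewrite -ltnS; apply: (leq_trans lt1); rewrite fsetIDA.
  by rewrite [X in X <= _](cardfsD1 v); case: (v \in _) => /=; lia.
have [chi sF] : exists chi, sat_within Y chi ([fset C] `|` (F `\ C)).
  apply: (sat_within_glue (Y := [fset v]) (phi := upd xpredT x)).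
  - by rewrite fsub1set.
  - move=> E; rewrite inE => /eqP->; exists x; split=> //.
    + by rewrite xv inE.
    + by rewrite updE.
  - exact: sH.
by exists chi; rewrite fsetD1K in sF.
Qed.

(** A proper subset [G] with at least as many clauses as variables in [Y] can be enlarged by a Hall
    violator of the rest, which adds more clauses than new variables. Starting from the empty set,
    this growth ends at [F] with a strict inequality. *)
Lemma tarsi (Y : {fset V}) F :
  (forall phi, ~ sat_within Y phi F) ->
  (forall C, C \in F -> exists phi, sat_within Y phi (F `\ C)) ->
  #|` vars F `&` Y| < #|` F|.
Proof.
move=> uF mF.
suff grow n G : #|` F `\` G| <= n -> G `<` F -> #|` vars G `&` Y| <= #|` G| ->
    #|` vars F `&` Y| < #|` F|.
  apply: (grow _ fset0 (leqnn _)); last by rewrite vars0 fset0I.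
  by rewrite fproper0; apply/eqP => F0; apply: (uF xpredT) => C; rewrite F0.
elim: n G => [|n IH] G Gn GF dG.
  by move: Gn GF; rewrite leqn0 cardfs_eq0 fsetD_eq0 fproperE => ->; rewrite andbF.
have GF' := fproper_sub GF.
have [phi sG] : exists phi, sat_within (vars G `&` Y) phi G.
  have /fsubsetPn[C CF CG] : ~~ (F `<=` G) by move: GF; rewrite fproperE => /andP[].
  have [phi sF] := mF C CF; exists phi => D DG.
  have [|x [xD xY xt]] := sF D.
    by rewrite !inE (fsubsetP GF') // andbT; apply: contraNneq CG => <-.
  by exists x; split=> //; rewrite inE xY andbT; apply/varsP; exists D => //; apply: lvar_cvars.
have [K [KF dK]] : exists K, K `<=` F `\` G /\
    #|` vars K `&` (Y `\` (vars G `&` Y))| < #|` K|.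
  apply: NNPP => nK.
  have [|psi sH] := @hall_sat (Y `\` (vars G `&` Y)) (F `\` G).
    move=> K KF; rewrite leqNgt; apply/negP => lt; apply: nK; by exists K.
  have [chi] := sat_within_glue (fsubsetIr _ _) sG sH.
  by rewrite fsetUDl fsetDv fsetD0 (fsetUidPr _ _ GF'); apply: uF.
have dGK : [disjoint G & K]%fset.
  rewrite fdisjoint_sym; apply: fdisjointWl KF _.
  by rewrite fdisjoint_sym; apply/fdisjointP => C CG; rewrite inE CG.
have cGK : #|` vars (G `|` K) `&` Y| < #|` G `|` K|.
  have : #|` vars (G `|` K) `&` Y| <=
         #|` vars K `&` (Y `\` vars G `&` Y)| + #|` vars G `&` Y|.
    rewrite -cardfsUI; apply: leq_trans (leq_addr _ _).
    apply: fsubset_leq_card; rewrite varsU; apply/fsubsetP=> v; rewrite !inE.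
    by case: (v \in vars K); case: (v \in vars G); case: (v \in Y).
  have := cardfsUI G K; move: dGK; rewrite -fsetI_eq0 => /eqP->.
  rewrite cardfs0; lia.
have GKF : G `|` K `<=` F by rewrite fsubUset GF' (fsubset_trans KF (fsubsetDl _ _)).
have [<-//|nGK] := eqVneq (G `|` K) F.
apply: (IH (G `|` K)); [|by rewrite fproperEneq nGK|exact: ltnW].
have := cardfsUI G K; move: (dGK); rewrite -fsetI_eq0 => /eqP->.
rewrite cardfs0; move: Gn; rewrite !cardfsDS // => Gn.
have := fsubset_leq_card GF'; have := fsubset_leq_card GKF.
have : 0 < #|` K| by apply: leq_ltn_trans dK.
lia.
Qed.

(** * Minimal premise sets and pure literals *)

(** Entailment is monotone in the premises, so it suffices to test deletions of single clauses, each
    refuted by an assignment. *)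
Lemma mps_forP G B : mps_for G B <-> entails G B /\
  (forall D, D \in G -> exists2 phi, satisfies phi (G `\ D) & ~ satisfies_clause phi B).
Proof.
split=> -[eG mG]; split=> //.
  move=> D DG; apply: NNPP => nphi; apply: (mG (G `\ D)); first exact: fproperD1.
  move=> phi sphi; apply: NNPP => nB; apply: nphi; by exists phi.
move=> K; rewrite fproperE => /andP[KG /fsubsetPn[D DG DK]] eK.
have [phi sphi] := mG D DG; apply; apply: eK; apply: satisfies_mono sphi.
by apply/fsubsetP=> C CK; rewrite !inE (fsubsetP KG) // andbT; apply: contraNneq DK => <-.
Qed.

Definition lits F : {fset literal V} := \bigcup_(C <- F) C.

Lemma litsP F x : reflect (exists2 C, C \in F & x \in C) (x \in lits F).
Proof.
apply: (iffP (bigfcupP _ _ _ _)) => -[C CF xC]; exists C => //.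
  by rewrite andbT in CF.
by rewrite CF.
Qed.

Lemma lits_mono G H : G `<=` H -> lits G `<=` lits H.
Proof.
by move=> /fsubsetP GH; apply/fsubsetP=> x /litsP[C CG xC]; apply/litsP; exists C; auto.
Qed.

Definition pure F : {fset literal V} := [fset x in lits F | lneg x \notin lits F].

Lemma pureE F x : (x \in pure F) = (x \in lits F) && (lneg x \notin lits F).
Proof. by rewrite !inE. Qed.

Lemma pure_clause F : is_clause (pure F).
Proof. by move=> x; rewrite !pureE => /andP[_ /negbTE->]. Qed.

Lemma cvars_pure F : cvars (pure F) `<=` vars F.
Proof.
apply/fsubsetP=> v /cvarsP[x]; rewrite pureE => /andP[/litsP[C CF xC] _] <-.
by apply/varsP; exists C => //; apply: lvar_cvars.
Qed.

(** The assignment refuting the deletion of a clause [D] containing [x] must falsify [D], hence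
    makes [lneg x] true, yet it falsifies [B]. *)
Lemma mps_for_neg G B x : mps_for G B -> x \in lits G -> lneg x \notin B.
Proof.
move=> /mps_forP[eG mG] /litsP[D DG xD]; apply/negP => nxB.
have [phi sphi nB] := mG D DG; case: (eqVneq (phi (lvar x)) x.2) => px.
  by apply: nB; apply: eG; apply: satisfies_D1 sphi _; exists x.
by apply: nB; exists (lneg x) => //=; case: (x.2) px; case: (phi _).
Qed.

(** Turning a pure [x] true in the assignment that refutes the deletion of its clause satisfies all
    of [G]. Then [B] becomes true, and only [x] can be the cause. *)
Lemma mps_for_pure G B x : mps_for G B -> x \in pure G -> x \in B.
Proof.
move=> mB; rewrite pureE => /andP[xG nxG].
have nxB := mps_for_neg mB xG.
have [eG mG] := proj1 (mps_forP _ _) mB.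
have /litsP[D DG xD] := xG; have [phi sphi nB] := mG D DG.
have : satisfies_clause (upd phi x) B.
  apply: eG; apply: (@satisfies_D1 _ D); last by exists x => //; rewrite updE.
  move=> C CG; apply: upd_keeps; last exact: sphi.
  apply: contraNN nxG => nxC; apply/litsP; exists C => //.
  by move: CG; rewrite !inE => /andP[].
case=> y yB; have [eqv|nv] := eqVneq (lvar y) (lvar x); last first.
  by rewrite upd_other // => yt; case: nB; exists y.
case: (eq_lvar eqv) => ye; first by rewrite -ye.
by rewrite -ye yB in nxB.
Qed.

Lemma mps_pure G : mps G -> mps_for G (pure G).
Proof.
move=> [B cB mB]; have [eG mG] := proj1 (mps_forP _ _) mB; apply/mps_forP; split.
  move=> phi sphi; apply: NNPP => npure.
  (* If no pure literal is true under [phi], falsifying [B] leaves every true literal occurring in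
     [G] true, so [G] stays satisfied while [B] is false. *)
  apply: (@falsifyP B phi cB); apply: eG => C CG.
  have [x xC xt] := sphi C CG; exists x => //.
  have xG : x \in lits G by apply/litsP; exists C.
  have nxB := mps_for_neg mB xG.
  rewrite falsify_other //; apply/negP => xB; apply: npure; exists x => //.
  rewrite pureE xG /=; apply/negP => nxG.
  by have := mps_for_neg mB nxG; rewrite lnegK xB.
move=> D /mG[phi sphi nB]; exists phi => // sP; apply: nB.
by apply: satisfies_clause_mono sP; apply/fsubsetP=> x; apply: mps_for_pure.
Qed.

(** * From total minimal premise sets to saturation and deficiency 1 *)

Definition nonpure_vars F : {fset V} :=
  [fset v in vars F | ((v, true) \in lits F) && ((v, false) \in lits F)].

Lemma nonpure_varsE F x :
  (lvar x \in nonpure_vars F) = (x \in lits F) && (lneg x \in lits F).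
Proof.
rewrite !inE; apply/andP/andP => [[_]|[xF nxF]].
  by case: x => v [] /= /andP[-> ->].
split; last by move: xF nxF; rewrite /lvar /lneg; case: x => v [] /= -> ->.
by have /litsP[C CF xC] := xF; apply/varsP; exists C => //; apply: lvar_cvars.
Qed.

Lemma total_mps_card F : total_mps F -> #|` F| <= #|` nonpure_vars F|.+1.
Proof.
have [n] := ubnP #|` F|; elim: n => // n IH in F *; rewrite ltnS => Fn [F0 tF].
have [D DF] : exists D, D \in F by apply/fset0Pn/eqP.
have cF := cardfsD1 D F; rewrite DF /= in cF.
have [F1|F1] := eqVneq (F `\ D) fset0; first by rewrite cF F1 cardfs0.
have sFD : F `\ D `<=` F := fsubD1set _ _.
have tFD : total_mps (F `\ D).
  split=> [|G GF]; first by apply/eqP.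
  by apply: tF; apply: fsubset_trans GF _.
suff lt : #|` nonpure_vars (F `\ D)| < #|` nonpure_vars F|.
  rewrite cF ltnS; apply: leq_trans (IH _ _ tFD) lt; by rewrite cF in Fn.
apply: fproper_ltn_card.
(* Otherwise the pure clause of [F] would contain that of [F] without [D], hence follow without [D],
   against minimality. *)
have [x xP xnP] : exists2 x, x \in pure (F `\ D) & x \notin pure F.
  apply/fsubsetPn/negP => sP.
  have /mps_pure/mps_forP[_ /(_ D DF)[phi sphi nP]] := tF F (fsubset_refl _) F0.
  have [_ /(_ _ (fsubset_refl _) (proj1 tFD)) /mps_pure/mps_forP[eP _]] := tFD.
  by apply: nP; apply: satisfies_clause_mono sP _; apply: eP.
move: xP xnP; rewrite !pureE negb_and negbK => /andP[xG nxG] xF.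
have xF' : x \in lits F := fsubsetP (lits_mono sFD) _ xG.
rewrite xF' /= in xF.
rewrite fproperE; apply/andP; split.
  apply/fsubsetP=> v; rewrite -[v]/(lvar (v, true)) !nonpure_varsE => /andP[vG nvG].
  by rewrite !(fsubsetP (lits_mono sFD)).
apply/fsubsetPn; exists (lvar x); rewrite nonpure_varsE ?xF' //.
by rewrite (negbTE nxG) andbF.
Qed.

Lemma total_mps_clash F C D : is_clause_set F -> total_mps F ->
  C \in F -> D \in F -> C != D -> exists2 x, x \in C & lneg x \in D.
Proof.
move=> cF [_ tF] CF DF nCD; apply: NNPP => nclash.
have /mps_pure mP : mps [fset C; D].
  apply: tF; first by rewrite fsubUset !fsub1set CF DF.
  by move=> /fsetP/(_ C); rewrite !inE eqxx.
have [_ /(_ D)] := proj1 (mps_forP _ _) mP.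
rewrite !inE eqxx orbT => /(_ isT)[phi sphi]; apply.
have : satisfies_clause phi C by apply: sphi; rewrite !inE nCD eqxx.
apply: satisfies_clause_mono; apply/fsubsetP=> x xC; rewrite pureE; apply/andP; split.
  by apply/litsP; exists C => //; rewrite !inE eqxx.
apply/negP => /litsP[E]; rewrite !inE => /orP[]/eqP-> nx.
  by have := cF C CF x xC; rewrite nx.
by apply: nclash; exists x.
Qed.

Lemma mu_card F : minimally_unsatisfiable F -> #|` vars F| < #|` F|.
Proof.
move=> [uF mF]; rewrite -[vars F]fsetIid; apply: tarsi.
  by move=> phi /sat_within_sat sF; apply: uF; exists phi.
move=> C CF; have [phi sphi] := mF C CF; exists phi => D DF.
have [x xD xt] := sphi D DF; exists x; split=> //.
apply/varsP; exists D; last exact: lvar_cvars.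
by move: DF; rewrite !inE => /andP[].
Qed.

Lemma deficiency1 F : deficiency F = 1%R <-> #|` F| = #|` vars F|.+1.
Proof. rewrite /deficiency; lia. Qed.

Lemma unsat_total_mps_SMU1 F :
  is_clause_set F -> unsatisfiable F -> total_mps F -> SMU1 F.
Proof.
move=> cF uF tF; have [F0 mF] := tF.
have muF : minimally_unsatisfiable F.
  split=> // C CF; have [B _ /mps_forP[_ /(_ C CF)[phi sphi _]]] := mF F (fsubset_refl _) F0.
  by exists phi.
split; last first.
  apply/deficiency1/eqP; rewrite eqn_leq mu_card // andbT.
  apply: leq_trans (total_mps_card tF) _; rewrite ltnS fsubset_leq_card //.
  by apply/fsubsetP=> v; rewrite !inE => /andP[].
split=> // C x CF xC.
(* Falsifying [C] satisfies each other clause at a clashing literal. The variable of [x] is not in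
   [C], so [x] can still be made true. *)
exists (upd (falsify C xpredT) x); rewrite fsetUC; apply: satisfiesU1.
  by rewrite fsetUC; apply: satisfies_clause1; rewrite updE.
move=> D; rewrite !inE => /andP[nDC DF].
have [y yD nyC] := total_mps_clash cF tF DF CF nDC.
exists y => //; rewrite upd_other; last first.
  by apply: contraNneq xC => <-; rewrite -[lvar y]/(lvar (lneg y)); apply: lvar_cvars.
by apply: falsify_hit => //; apply: cF.
Qed.

(** * Singular variables of saturated clause-sets of deficiency 1 *)

Lemma mu_falsifies F C phi : unsatisfiable F -> satisfies phi (F `\ C) ->
  ~ satisfies_clause phi C.
Proof. by move=> uF sphi sC; apply: uF; exists phi; apply: satisfies_D1 sphi sC. Qed.

Lemma mu_neg F x : minimally_unsatisfiable F -> x \in lits F -> lneg x \in lits F.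
Proof.
move=> [uF mF] /litsP[C CF xC]; apply/negPn/negP => nxF.
have [phi sphi] := mF C CF; apply: uF; exists (upd phi x).
apply: (@satisfies_D1 _ C); last by exists x; rewrite ?updE.
move=> D DF; apply: upd_keeps; last exact: sphi.
apply: contraNN nxF => nxD; apply/litsP; exists D => //.
by move: DF; rewrite !inE => /andP[].
Qed.

(** For a variable outside [C] this is saturation. Otherwise [lneg x] is in [C], and any model of
    the other clauses falsifies [C]. *)
Lemma smu_assign F C x : saturated_minimally_unsatisfiable F -> C \in F -> x \notin C ->
  exists2 phi, satisfies phi (F `\ C) & phi (lvar x) = x.2.
Proof.
move=> [[uF mF] sF] CF xC.
have [vC|vC] := boolP (lvar x \in cvars C); last first.
  have [phi sphi] := sF C x CF vC; exists phi.
    by apply: satisfies_mono sphi; apply: fsubsetUl.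
  have : satisfies_clause phi (x |` C) by apply: sphi; rewrite fsetUC !inE fsetUC eqxx orbT.
  case/satisfies_clauseU1 => // sC; case: (@mu_falsifies F C phi) => //.
  by apply: satisfies_mono sphi; apply: fsubsetUl.
have [phi sphi] := mF C CF; exists phi => //.
have nxC : lneg x \in C.
  by case/cvarsP: vC => y yC /eq_lvar[] ye; rewrite -ye // yC in xC *.
have nsC := mu_falsifies uF sphi.
apply/eqP/negPn/negP => nx; apply: nsC; exists (lneg x) => //=.
by case: x.2 nx; case: (phi _).
Qed.

Definition occ F x := [fset C in F | x \in C].

Lemma occE F x C : (C \in occ F x) = (C \in F) && (x \in C).
Proof. by rewrite !inE. Qed.

Definition deg F v := #|` [fset C in F | v \in cvars C]|.

(* Setting [x] to true leaves a minimally unsatisfiable rest, which by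
   minimality of the degree loses no variable besides that of [x]; the lower
   bound on its deficiency then bounds the number of clauses removed. *)
Lemma smu1_occ_le1 F x : SMU1 F -> lvar x \in vars F ->
  (forall w, w \in vars F -> deg F (lvar x) <= deg F w) -> #|` occ F x| <= 1.
Proof.
move=> [sF /deficiency1 dF] xF minx; have [muF _] := sF; have [uF mF] := muF.
set H := F `\` occ F x.
have HE D : (D \in H) = (D \in F) && (x \notin D).
  by rewrite inE occE; case: (D \in F); rewrite ?andbT ?andbF.
have oF : occ F x `<=` F by apply/fsubsetP=> D; rewrite occE => /andP[].
have nxF : lneg x \in lits F.
  have /varsP[C CF /cvarsP[y yC /eq_lvar[] ye]] := xF.
    by apply: mu_neg muF _; apply/litsP; exists C => //; rewrite -ye.
  by apply/litsP; exists C => //; rewrite -ye.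
(* If [w] vanished, all clauses with [w] would contain [x], and by minimal degree so would all
   clauses with the variable of [x]. A clause with [lneg x] would then be a tautology, impossible
   here. *)
have varsH : vars H `&` (vars F `\ lvar x) = vars F `\ lvar x.
  apply/fsetIidPr/fsubsetP=> w; rewrite !inE => /andP[wx wF].
  apply/negPn/negP => wH.
  have ow : [fset C in F | w \in cvars C] `<=` occ F x.
    apply/fsubsetP=> D; rewrite !inE => /andP[DF wD]; rewrite DF /=.
    apply/negPn/negP=> xD; case/negP: wH; apply/varsP; exists D => //.
    by rewrite HE DF.
  have ov : occ F x `<=` [fset C in F | lvar x \in cvars C].
    by apply/fsubsetP=> D; rewrite !inE => /andP[-> /lvar_cvars].
  have eqo : occ F x = [fset C in F | lvar x \in cvars C].
    apply/eqP; rewrite eqEfcard ov /=.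
    exact: leq_trans (minx w wF) (fsubset_leq_card ow).
  have /litsP[D DF nxD] := nxF.
  have : D \in H -> False.
    move=> DH; have : D \in occ F x by rewrite eqo !inE DF; apply: (lvar_cvars nxD).
    by move: DH; rewrite HE occE => /andP[_ /negbTE->]; rewrite andbF.
  rewrite HE DF /= => nH; have xD : x \in D by apply/negPn/negP.
  have [phi sphi] := mF D DF; apply: (mu_falsifies uF sphi).
  have [px|px] := eqVneq (phi (lvar x)) x.2; first by exists x.
  by exists (lneg x) => //=; case: x.2 px; case: (phi _).
(* Tarsi's lemma applies without the variable of [x]: for [C] in [H], saturation gives a model of
   [F] without [C] that makes [x] true, so clauses of [H] are satisfied at other variables. *)
have : #|` vars F `\ lvar x| < #|` H|.
  rewrite -varsH; apply: tarsi => [phi sphi|C].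
    apply: uF; exists (upd phi x) => C CF.
    have [xC|xC] := boolP (x \in C); first by exists x; rewrite ?updE.
    have [|y [yC + yt]] := sphi C; first by rewrite HE CF.
    by rewrite !inE => /andP[yx _]; exists y; rewrite ?upd_other.
  rewrite HE => /andP[CF xC]; have [phi sphi px] := smu_assign sF CF xC.
  exists phi => D; rewrite in_fsetD1 HE => /and3P[nDC DF xD].
  have [|y yD yt] := sphi D; first by rewrite !inE nDC.
  exists y; split=> //; rewrite !inE; apply/andP; split; last first.
    by apply/varsP; exists D => //; apply: lvar_cvars.
  apply/eqP => /eq_lvar[] ye; first by rewrite -ye yD in xD.
  by move: yt; rewrite ye [lvar _]/(lvar x) px /=; case: x.2.
rewrite (cardfsDS oF).
have := cardfsD1 (lvar x) (vars F); rewrite xF.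
have := fsubset_leq_card oF.
lia.
Qed.

(** The degree ignores signs, so at a variable of minimal degree the bound on occurrences applies to
    both. [mu_neg] supplies an occurrence of each sign. *)
Lemma smu1_singular_var F : SMU1 F -> vars F != fset0 ->
  exists2 v, v \in vars F & forall b, exists C, occ F (v, b) = [fset C].
Proof.
move=> sF /fset0Pn[v0 v0F].
have [v _ minv] := @arg_minnP _ [` v0F] xpredT (fun u : vars F => deg F (val u)) isT.
exists (val v) => [|b]; first exact: valP.
have muF := proj1 (proj1 sF).
have xF : lvar (val v, b) \in vars F by exact: valP.
have le1 : #|` occ F (val v, b)| <= 1.
  by apply: smu1_occ_le1 => // w wF; apply: (minv [` wF]).
have /litsP[C CF xC] : (val v, b) \in lits F.
  have /varsP[C CF /cvarsP[y yC /eq_lvar[] ye]] := xF.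
    by apply/litsP; exists C => //; rewrite -ye.
  rewrite -[(_, _)]lnegK; apply: mu_neg muF _.
  by apply/litsP; exists C => //; rewrite -ye.
exists C; apply/eqP; rewrite eq_sym eqEfcard cardfs1 le1 andbT fsub1set.
by rewrite occE CF.
Qed.

(* Saturation forces the only two clauses containing a singular variable to
   agree on all other literals. *)
Lemma smu1_split F : is_clause_set F -> SMU1 F -> vars F != fset0 ->
  exists x C R, [/\ lvar x \notin vars (C |` R), C \notin R,
    F = (x |` C) |` ((lneg x |` C) |` R) & SMU1 (C |` R)].
Proof.
move=> cF sF vF; have [v vvF occ1] := smu1_singular_var sF vF.
have [A1 oA1] := occ1 true; have [A0 oA0] := occ1 false.
(* Indexing the two clauses by the sign of [v] lets one argument serve both. *)
pose A b := if b then A1 else A0.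
have oA b : occ F (v, b) = [fset A b] by case: b.
have [smF /deficiency1 dF] := sF; have [[uF mF] _] := smF.
have /all_and2[AF vA] b : A b \in F /\ (v, b) \in A b.
  by apply/andP; rewrite -occE oA inE.
have vnA b : (v, ~~ b) \notin A b := cF _ (AF b) _ (vA b).
have nA b : A (~~ b) != A b by apply: contraNneq (vnA b) => <-; apply: vA.
pose R := F `\ A true `\ A false.
have RE b D : (D \in R) = [&& D != A b, D != A (~~ b) & D \in F].
  by rewrite !inE; case: b; rewrite //= andbCA.
have vR : v \notin vars R.
  apply/varsP => -[D DR] /cvarsP[[w b] xD /= wv]; rewrite {}wv in xD.
  have : D \in occ F (v, b) by move: DR; rewrite occE (RE b) xD => /and3P[_ _ ->].
  by move: DR; rewrite oA inE (RE b) => /and3P[/negbTE->].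
(* Otherwise [y] satisfies [A b], which frees [v] to satisfy [A (~~ b)]. *)
have unA b phi : satisfies phi R -> ~ satisfies_clause phi (A b `\ (v, b)).
  move=> sR [y]; rewrite !inE => /andP[yv yA] yt; apply: uF.
  have yv' : lvar y != v.
    apply/eqP => /(@eq_lvar (v, b)) [] ye; first by rewrite ye eqxx in yv.
    by rewrite ye (negbTE (vnA b)) in yA.
  exists (upd phi (v, ~~ b)) => D DF.
  have [->|DA'] := eqVneq D (A (~~ b)); first by exists (v, ~~ b); rewrite ?updE.
  have [->|DA] := eqVneq D (A b); first by exists y; rewrite ?upd_other.
  by apply: (proj2 (@upd_satisfies phi (v, ~~ b) R vR)); rewrite // (RE b) DA' DA.
(* A literal missing on the other side could, by saturation, be made true in a model of [R],
   contradicting [unA]. *)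
have subA b : A b `\ (v, b) `<=` A (~~ b) `\ (v, ~~ b).
  apply/fsubsetP=> x xA; apply/negPn/negP => xA'.
  have := xA; rewrite !inE => /andP[_ xAb].
  have xvb : x != (v, ~~ b) by apply: contraNneq (vnA b) => <-.
  have {}xA' : x \notin A (~~ b) by move: xA'; rewrite !inE xvb.
  have [phi sphi px] := smu_assign smF (AF (~~ b)) xA'.
  apply: (unA b phi); last by exists x.
  apply: satisfies_mono sphi; apply/fsubsetP=> D.
  by rewrite (RE b) in_fsetD1 => /and3P[_ -> ->].
pose C := A true `\ (v, true).
have CE b : A b `\ (v, b) = C.
  by case: b => //; apply/eqP; rewrite eqEfsubset (subA false) (subA true).
have AE b : (v, b) |` C = A b by rewrite -(CE b) fsetD1K.
have vC : v \notin cvars C.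
  apply/cvarsP => -[y yC yv]; have := yC; rewrite !inE.
  have [->|->] := @eq_lvar (v, true) y yv; first by rewrite eqxx.
  by rewrite /lneg /= (negbTE (vnA true)) andbF.
have CR : C \notin R.
  apply/negP => CR; have [phi sphi] := mF _ (AF true).
  have sR : satisfies phi R by apply: satisfies_mono sphi; apply: fsubsetDl.
  by apply: (unA true phi sR); apply: sR.
have vCR : v \notin vars (C |` R).
  apply/varsP => -[D]; rewrite in_fset1U => /orP[/eqP->|DR]; first exact/negP.
  by move=> vD; case/negP: vR; apply/varsP; exists D.
have FE : F = A true |` (A false |` R).
  apply/fsetP=> D; rewrite !in_fset1U (RE true).
  have [->|_] := eqVneq D (A true); first by rewrite AF.
  by have [->|_] := eqVneq D (A false); rewrite ?AF.
have uCR : unsatisfiable (C |` R).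
  move=> [phi sphi]; apply: (unA true phi).
    by apply: satisfies_mono sphi; apply: fsubsetUr.
  by apply: sphi; rewrite !inE eqxx.
(* Both [A true] and [A false] hold under [phi], but [v] satisfies only one of them, so [C]
   holds. *)
have transfer phi E : E \in R -> satisfies phi (F `\ E) -> satisfies phi ((C |` R) `\ E).
  rewrite (RE true) => /and3P[EA EA' EF] sphi D; rewrite in_fsetD1 in_fset1U (RE true).
  move=> /andP[DE /orP[/eqP->|/and3P[_ _ DF]]]; last by apply: sphi; rewrite !inE DE.
  have sA b : satisfies_clause phi (A b).
    by apply: sphi; rewrite in_fsetD1 AF andbT; case: b; rewrite eq_sym.
  move: (sA true) (sA false); rewrite -!AE.
  move=> /satisfies_clauseU1[/= pv|//] /satisfies_clauseU1[/= pv'|//].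
  by rewrite /lvar /= in pv pv'; rewrite pv in pv'.
have transferC phi : satisfies phi (F `\ A true) -> satisfies phi ((C |` R) `\ C).
  apply: satisfies_mono; apply/fsubsetP=> D; rewrite in_fsetD1 in_fset1U (RE true) in_fsetD1.
  by case: (eqVneq D C) => //= _ /and3P[-> _ ->].
have mCR E : E \in C |` R -> satisfiable ((C |` R) `\ E).
  rewrite in_fset1U => /orP[/eqP->|ER].
    by have [phi /transferC] := mF _ (AF true); exists phi.
  have EF : E \in F by move: ER; rewrite (RE true) => /and3P[].
  by have [phi /transfer] := mF E EF; exists phi; auto.
have varsF : vars F = v |` vars (C |` R).
  rewrite FE -!AE; apply/fsetP=> w; rewrite in_fset1U; apply/varsP/idP.
    move=> [D]; rewrite !in_fset1U => DF /cvarsP[y yD <-].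
    have [//|yv /=] := eqVneq (lvar y) v.
    have yC b : y \in (v, b) |` C -> y \in C.
      by rewrite in_fset1U => /orP[/eqP ye|//]; rewrite ye eqxx in yv.
    apply/varsP; case/or3P: DF => [/eqP De|/eqP De|DR].
    - by exists C; rewrite ?in_fset1U ?eqxx // lvar_cvars // (yC true) // -De.
    - by exists C; rewrite ?in_fset1U ?eqxx // lvar_cvars // (yC false) // -De.
    - by exists D; rewrite ?in_fset1U ?DR ?orbT // lvar_cvars.
  case/orP => [/eqP->|/varsP[D]].
    exists ((v, true) |` C); first by rewrite in_fset1U eqxx.
    by apply: (lvar_cvars (x := (v, true))); rewrite in_fset1U eqxx.
  rewrite in_fset1U => /orP[/eqP->|DR] wD; last first.
    by exists D => //; rewrite !in_fset1U DR !orbT.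
  exists ((v, true) |` C); first by rewrite in_fset1U eqxx.
  case/cvarsP: wD => y yC <-; apply: lvar_cvars.
  by rewrite in_fset1U yC orbT.
exists (v, true), C, R; split=> //; first by rewrite [in LHS]FE -!AE.
split; last first.
  apply/deficiency1; move: dF; rewrite varsF FE !cardfsU1 vCR CR.
  by rewrite in_fset1U negb_or eq_sym nA (RE true) (RE false) !eqxx /=; lia.
split=> // E x ECR xE.
suff [phi sphi px] : exists2 phi, satisfies phi ((C |` R) `\ E) & phi (lvar x) = x.2.
  exists phi; rewrite fsetUC; apply: satisfiesU1 => //.
  by rewrite fsetUC; apply: satisfies_clause1.
have xnE : x \notin E by apply: contraNN xE; apply: lvar_cvars.
have [xv|xv] := eqVneq (lvar x) v.
  have [phi sphi] := mCR E ECR; exists (upd phi x); last exact: updE.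
  apply/upd_satisfies => //; rewrite xv; apply: contraNN vCR.
  by apply/fsubsetP/vars_mono/fsubD1set.
move: ECR; rewrite in_fset1U => /orP[/eqP EC|ER].
  have xA : x \notin A true.
    rewrite -AE in_fset1U negb_or -EC xnE andbT.
    by apply: contraNneq xv => ->.
  have [phi /transferC sphi px] := smu_assign smF (AF true) xA.
  by exists phi => //; rewrite EC.
have EF : E \in F by move: ER; rewrite (RE true) => /and3P[].
by have [phi /transfer] := smu_assign smF EF xnE; exists phi; auto.
Qed.

(** * Undoing the contraction of two clauses *)

Lemma cvars_pureN F x : lvar x \notin vars F -> lvar x \notin cvars (pure F).
Proof. by apply: contraNN; apply/fsubsetP/cvars_pure. Qed.

(** The conclusion gains [x] too: with [x] false everything reduces to the old premise set, and with
    [x] true the new conclusion holds. Taking the pure clause as old conclusion keeps it free of the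
    variable of [x]. *)
Lemma mps_extend_clause C R x : C \notin R -> lvar x \notin vars (C |` R) ->
  mps (C |` R) -> mps ((x |` C) |` R).
Proof.
move=> CR xCR /mps_pure; have := @pure_clause (C |` R).
have := cvars_pureN xCR; move: (pure _) => B xB cB /mps_forP[eB mB].
have xnB b : (lvar x, b) \notin B.
  by apply: contraNN xB => xB; rewrite -[lvar x]/(lvar (lvar x, b)) lvar_cvars.
have xR : lvar x \notin vars R.
  by apply: contraNN xCR; apply/fsubsetP/vars_mono/fsubsetUr.
have nxB phi : ~ satisfies_clause phi B -> ~ satisfies_clause (upd phi (lneg x)) (x |` B).
  move=> nB /satisfies_clauseU1[|/upd_clause sB]; last by apply: nB; apply: sB.
  by rewrite -[lvar x]/(lvar (lneg x)) updE /=; case: x.2.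
exists (x |` B).
  move=> y; rewrite !inE negb_or => /orP[/eqP->|yB].
    have -> : lneg x \notin B := xnB (~~ x.2).
    by rewrite andbT; apply/eqP; case: (x) => w [].
  by rewrite cB // andbT; apply: contraNneq xB => <-; apply: (lvar_cvars yB).
apply/mps_forP; split.
  move=> phi sphi; have : satisfies_clause phi (x |` C) by apply: sphi; rewrite !inE eqxx.
  case/satisfies_clauseU1 => [|sC]; first exact: satisfies_clause1.
  apply: (@satisfies_clause_mono _ B); first exact: fsubsetUr.
  by apply: eB; apply: satisfiesU1 => //; apply: satisfies_mono sphi; apply: fsubsetUr.
move=> D; rewrite !inE => DG.
have [DR|DR] := boolP (D \in R).
  have [|phi sphi nB] := mB D; first by rewrite !inE DR orbT.
  exists (upd phi (lneg x)); last exact: nxB.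
  move=> E; rewrite !inE => /andP[ED /orP[/eqP->|ER]].
    apply: (@satisfies_clause_mono _ C); first exact: fsubsetUr.
    apply/upd_clause.
      by apply: contraNN xCR; apply/fsubsetP/cvars_sub; rewrite !inE eqxx.
    by apply: sphi; rewrite !inE eqxx andbT; apply: contraNneq CR => ->.
  apply/upd_clause.
    by apply: contraNN xR; apply/fsubsetP/cvars_sub.
  by apply: sphi; rewrite !inE ED ER orbT.
have [|phi sphi nB] := mB C; first by rewrite !inE eqxx.
exists (upd phi (lneg x)); last exact: nxB.
rewrite (negbTE DR) orbF in DG; rewrite (eqP DG) => E; rewrite !inE => /andP[ED].
rewrite (negbTE ED) /= => ER; apply/upd_clause.
  by apply: contraNN xR; apply/fsubsetP/cvars_sub.
by apply: sphi; rewrite !inE ER orbT andbT; apply: contraNneq CR => <-.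
Qed.

(** Resolving the two new clauses gives back [C], so the conclusion stays. If one of them is
    deleted, the value of [x] satisfies the other, and the assignment refuting the deletion of [C]
    serves again. *)
Lemma mps_split_clause C R x : C \notin R -> lvar x \notin vars (C |` R) ->
  mps (C |` R) -> mps ((x |` C) |` ((lneg x |` C) |` R)).
Proof.
move=> CR xCR /mps_pure; have := @pure_clause (C |` R).
have := cvars_pureN xCR; move: (pure _) => B xB cB /mps_forP[eB mB].
have xR : lvar x \notin vars R.
  by apply: contraNN xCR; apply/fsubsetP/vars_mono/fsubsetUr.
exists B => //; apply/mps_forP; split.
  move=> phi sphi; apply: eB; apply: satisfiesU1; last first.
    by apply: satisfies_mono sphi; rewrite fsetUA; apply: fsubsetUr.
  have /satisfies_clauseU1[px|//] : satisfies_clause phi (x |` C).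
    by apply: sphi; rewrite !inE eqxx.
  have /satisfies_clauseU1[|//] : satisfies_clause phi (lneg x |` C).
    by apply: sphi; rewrite !inE eqxx orbT.
  by rewrite [lvar _]/(lvar x) px /=; case: x.2.
have drop y : lvar y = lvar x -> exists2 phi,
    satisfies phi ((y |` C) |` R) & ~ satisfies_clause phi B.
  move=> yx; have [|phi sphi nB] := mB C; first by rewrite !inE eqxx.
  exists (upd phi y); last by move/upd_clause => sB; apply: nB; apply: sB; rewrite yx.
  apply: satisfiesU1; first by apply: satisfies_clause1; rewrite updE.
  apply/upd_satisfies; first by rewrite yx.
  apply: satisfies_mono sphi; apply/fsubsetP=> D DR.
  by rewrite !inE DR orbT andbT; apply: contraNneq CR => <-.
move=> D; rewrite !inE => DG.
have [DR|DR] := boolP (D \in R).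
  have [|phi sphi nB] := mB D; first by rewrite !inE DR orbT.
  exists phi => // E; rewrite !inE => /andP[ED].
  have sC : satisfies_clause phi C.
    by apply: sphi; rewrite !inE eqxx andbT; apply: contraNneq CR => ->.
  case/or3P => [/eqP->|/eqP->|ER].
  - by apply: satisfies_clause_mono sC; apply: fsubsetUr.
  - by apply: satisfies_clause_mono sC; apply: fsubsetUr.
  - by apply: sphi; rewrite !inE ED ER orbT.
have [y yx sub] : exists2 y, lvar y = lvar x &
    ((x |` C) |` ((lneg x |` C) |` R)) `\ D `<=` (y |` C) |` R.
  rewrite (negbTE DR) orbF in DG; case/orP: DG => /eqP->; [exists (lneg x)|exists x] => //.
    by apply/fsubsetP=> E; rewrite !inE => /andP[/negbTE->].
  by apply/fsubsetP=> E; rewrite !inE => /andP[/negbTE->].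
have [phi sphi nB] := drop y yx; exists phi => //; exact: satisfies_mono sphi.
Qed.

(** A subset with one or both new clauses comes from [C] and its part in [R] by extension or
    splitting. With neither, it lies within [R]. *)
Lemma total_mps_split C R x : C \notin R -> lvar x \notin vars (C |` R) ->
  total_mps (C |` R) -> total_mps ((x |` C) |` ((lneg x |` C) |` R)).
Proof.
move=> CR xCR [_ tF]; split; first by move/fsetP/(_ (x |` C)); rewrite !inE eqxx.
move=> G GF G0.
have SR : G `&` R `<=` R := fsubsetIr _ _.
have CS : C \notin G `&` R by rewrite inE (negbTE CR) andbF.
have xCS : lvar x \notin vars (C |` (G `&` R)).
  by apply: contraNN xCR; apply/fsubsetP/vars_mono/fsetUS.
have mCS : mps (C |` (G `&` R)).
  by apply: tF; [apply: fsetUS | move/fsetP/(_ C); rewrite !inE eqxx].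
have cases E : E \in G -> [\/ E = x |` C, E = lneg x |` C | E \in R].
  by move/(fsubsetP GF); rewrite !inE => /or3P[/eqP|/eqP|]; [exact: Or31|exact: Or32|exact: Or33].
have [xG|xG] := boolP (x |` C \in G); have [nxG|nxG] := boolP (lneg x |` C \in G).
- suff -> : G = (x |` C) |` ((lneg x |` C) |` (G `&` R)) by apply: mps_split_clause.
  apply/fsetP=> E; rewrite !inE; apply/idP/idP => [EG|/or3P[/eqP->|/eqP->|/andP[]]//].
  by case: (cases E EG) => [->|->|->]; rewrite ?eqxx ?orbT // EG !orbT.
- suff -> : G = (x |` C) |` (G `&` R) by apply: mps_extend_clause.
  apply/fsetP=> E; rewrite !inE; apply/idP/idP => [EG|/orP[/eqP->|/andP[]]//].
  by case: (cases E EG) => [->|EE|->]; rewrite ?eqxx ?EG ?orbT //; rewrite -EE EG in nxG.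
- suff -> : G = (lneg x |` C) |` (G `&` R) by apply: mps_extend_clause.
  apply/fsetP=> E; rewrite !inE; apply/idP/idP => [EG|/orP[/eqP->|/andP[]]//].
  by case: (cases E EG) => [EE|->|->]; rewrite ?eqxx ?EG ?orbT //; rewrite -EE EG in xG.
- apply: tF G0; apply/fsubsetP=> E EG; rewrite !inE.
  by case: (cases E EG) => [EE|EE|->]; rewrite ?orbT //; rewrite -EE EG in xG nxG.
Qed.

Lemma total_mps1 C : is_clause C -> total_mps [fset C].
Proof.
move=> cC; split; first by move/fsetP/(_ C); rewrite !inE eqxx.
move=> G GC G0; have -> : G = [fset C].
  by move: GC; rewrite fsubset1 => /orP[/eqP|/eqP].
exists C => //; apply/mps_forP; split=> [phi|D]; first by apply; rewrite inE.
rewrite inE => /eqP->; exists (falsify C xpredT); last exact: falsifyP.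
by rewrite fsetDv => E; rewrite inE.
Qed.

Lemma SMU1_total_mps F : is_clause_set F -> SMU1 F -> total_mps F.
Proof.
have [n] := ubnP #|` F|; elim: n => // n IH in F *; rewrite ltnS => Fn cF sF.
have [v0|vF] := eqVneq (vars F) fset0.
  have /eqP/cardfs1P[C FC] : #|` F| = 1.
    by have [_ /deficiency1->] := sF; rewrite v0 cardfs0.
  by rewrite FC; apply: total_mps1; apply: cF; rewrite FC inE.
have [x [C [R [xCR CR FE sCR]]]] := smu1_split cF sF vF.
have cFE D : D \in x |` C |` (lneg x |` C |` R) -> D \in F by rewrite FE.
rewrite FE; apply: total_mps_split => //; apply: IH => //.
  (* With deficiency 1 on both sides, clause numbers compare as variable numbers do, and the
     variable of [x] is lost. *)
  apply: leq_trans Fn.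
  have [_ /deficiency1->] := sF; have [_ /deficiency1->] := sCR; rewrite ltnS.
  apply: fproper_ltn_card; rewrite fproperE; apply/andP; split.
    apply/fsubsetP=> w /varsP[D]; rewrite !inE => /orP[/eqP->|DR] wD.
      apply/varsP; exists (x |` C); first by apply: cFE; rewrite !inE eqxx.
      by case/cvarsP: wD => y yC <-; apply: lvar_cvars; rewrite !inE yC orbT.
    by apply/varsP; exists D => //; apply: cFE; rewrite !inE DR !orbT.
  apply/fsubsetPn; exists (lvar x) => //; apply/varsP; exists (x |` C).
    by apply: cFE; rewrite !inE eqxx.
  by apply: lvar_cvars; rewrite !inE eqxx.
move=> D; rewrite !inE => /orP[/eqP->|DR]; last by apply: cF; apply: cFE; rewrite !inE DR !orbT.
have cxC : is_clause (x |` C) by apply: cF; apply: cFE; rewrite !inE eqxx.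
by move=> y yC; have := cxC y; rewrite !inE yC orbT negb_or => /(_ isT)/andP[].
Qed.

End TotalMinimalPremiseSets.

Theorem theorem5p12 (V : choiceType) (F : {fset {fset literal V}}) :
  is_clause_set F -> unsatisfiable F -> (total_mps F <-> SMU1 F).
Proof.
by move=> cF uF; split; [apply: unsat_total_mps_SMU1 | apply: SMU1_total_mps].
Qed.
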